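(* Let $n\ge 2$ be an integer, let $q=p^t$ be a power of a prime $p$, and let $K$ be a Kakeya set in $AG(n,q)$, i.e. a set of points of $AG(n,q)$ containing a line in every direction. Let $C_{n-1}$ be the $GF(p)$-linear code spanned by the lines of $PG(n-1,q)$. Then \[ |K|\ \ge\ \dim C_{n-1}^{\perp}\ \ge\ \binom{q+n-2}{n-1}\ \ge\ \frac{q^{n-1}}{(n-1)!}. \]
   Context: $AG(n,q)$ and $PG(n,q)$ are the $n$-dimensional affine and projective spaces over the finite field $GF(q)$. A direction of $AG(n,q)$ is a parallel class of lines; equivalently a point of the hyperplane at infinity $PG(n-1,q)$. A Kakeya set (Besicovitch set) in $AG(n,q)$ is a set of points that, for every direction, contains all the points of at least one affine line with that direction. The code $C_{n-1}$ is the $GF(p)$-subspace of $GF(p)^{\mathcal P}$, where $\mathcal P$ is the set of points of $PG(n-1,q)$, spanned by the characteristic vectors of the lines of $PG(n-1,q)$. Its dual $C_{n-1}^\perp$ is the orthogonal complement with respect to the standard bilinear form $\langle u,v\rangle=\sum_{P\in\mathcal P}u_Pv_P$, and $\dim$ denotes dimension over $GF(p)$. *)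

(* Defs.v *)
From HB Require Import structures.
From mathcomp Require Import all_boot all_algebra.

Set Implicit Arguments.
Unset Strict Implicit.
Unset Printing Implicit Defensive.

Import GRing.Theory.
Local Open Scope ring_scope.

(* The subspaces of a finite vector space form a finType; it is needed to index
   words by the points of PG(n-1, q) and to enumerate the lines. *)
Section FiniteSubspaces.

Import VectorInternalTheory.

Variables (F : finFieldType) (V : vectType F).

HB.instance Definition _ := [Countable of {vspace V} by <:].
HB.instance Definition _ := [Finite of {vspace V} by <:].

End FiniteSubspaces.

(* Points and lines of PG(n-1, F) are the subspaces of F^n of dimension 1
   and 2.  A point is also a direction of AG(n, F): the parallel class of the
   lines x + D, x in F^n. *)
Definition pg_point (F : finFieldType) (n : nat) : finType :=
  {D : {vspace 'rV[F]_n} | \dim D == 1%N}.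

Definition pg_line (F : finFieldType) (n : nat) : finType :=
  {L : {vspace 'rV[F]_n} | \dim L == 2}.

Definition incident (F : finFieldType) (n : nat)
  (P : pg_point F n) (L : pg_line F n) : bool := (val P <= val L)%VS.

Definition ag_line (F : finFieldType) (n : nat)
  (x : 'rV[F]_n) (D : pg_point F n) : {set 'rV[F]_n} :=
  [set x + v | v in [pred v | v \in val D]].

Definition kakeya (F : finFieldType) (n : nat) (K : {set 'rV[F]_n}) : Prop :=
  forall D : pg_point F n, exists x : 'rV[F]_n, ag_line x D \subset K.

Section Codes.

(* The copy k^o is k with its structure of vector space over itself. *)
Variables (k : finFieldType) (I : finType).
Local Notation word := {ffun I -> k^o}.

Definition dotp (u v : word) : k^o := \sum_i (u i : k) * v i.

Fact dotp_is_linear u : linear (dotp u).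
Proof.
move=> a v w; rewrite /dotp scaler_sumr -big_split /=; apply: eq_bigr => i _.
by rewrite !ffunE mulrDr [a *: v i]/(a * v i) [RHS]/(a * _ + _) mulrCA.
Qed.

HB.instance Definition _ u :=
  GRing.isLinear.Build k word k^o *:%R (dotp u) (dotp_is_linear u).

Definition dual_code (C : {vspace word}) : {vspace word} :=
  (\bigcap_(u | u \in C) lker (linfun (dotp u)))%VS.

Lemma mem_dual_code (C : {vspace word}) (v : word) :
  reflect (forall u, u \in C -> dotp u v = 0) (v \in dual_code C).
Proof.
rewrite memvE; apply: (iffP subv_bigcapP) => H u uC; move: (H u uC);
by rewrite -?memvE memv_ker lfunE /= => /eqP.
Qed.

End Codes.

Definition line_vector (p : nat) (F : finFieldType) (n : nat)
  (L : pg_line F n) : {ffun pg_point F n -> ('F_p)^o} :=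
  [ffun P => (incident P L)%:R].

Definition line_code (p : nat) (F : finFieldType) (n : nat) :
  {vspace {ffun pg_point F n -> ('F_p)^o}} :=
  <<[seq line_vector p L | L : pg_line F n]>>%VS.

(* Main.v *)
From HB Require Import structures.
Require Import Defs.
From mathcomp Require Import all_boot all_algebra.
From mathcomp Require Import all_field zify.

Set Implicit Arguments.
Unset Strict Implicit.
Unset Printing Implicit Defensive.

Import GRing.Theory Num.Theory.

(** Write C for the line code of PG(n-1, q) and call [cone u] the extension of a
word u on PG(n-1, q) to AG(n, q) that takes the value u(<y>) at a vector y <> 0
and the value 0 at the origin.

Upper bound.  An affine line x + D that misses the origin is projected from the
origin onto the projective line <x> + D minus the point D.  Hence, for u in the
dual code, the sum of [cone u] over x + D is - u(D); this also holds when
x + D = D, because then the sum is (q - 1) u(D) ([sum_cone_dual_code]).  If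
[cone u] vanishes on a Kakeya set K, then choosing for each D a line of K with
direction D gives u(D) = 0.  So restricting [cone u] to K is injective on the
dual code ([kakeya_dim_dual_code]).

Lower bound.  The dimension of the dual code is unchanged when the scalars are
extended from GF(p) to F, because a matrix has the same rank over both fields
([dim_dual_code_ge]).  Over F, a monomial of degree q - 1 in n variables is
constant on the nonzero multiples of a vector, so it is the cone of a word, and
this word is orthogonal to every line: the sum of f(x + a d) over a in F is
minus the coefficient of a^(q-1), i.e. - f(d) ([sum_monomial_word]).  The
exponents of these monomials are less than q, so they are linearly independent
as functions on F^n ([monomial_free]), and there are 'C(q + n - 2, n - 1) of
them.  *)

Local Open Scope ring_scope.

(** * Power sums over a finite field *)

Section PowerSums.

Variable F : finFieldType.
Local Notation q := #|F|.

(** Translation by 1 permutes F and adds q to the sum of all elements. *)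
Lemma card_field_natr : q%:R = 0 :> F.
Proof.
apply: (addrI (\sum_(a : F) a)); rewrite addr0 [RHS](reindex_inj (addIr 1)) /=.
by rewrite big_split /= sumr_const.
Qed.

(** For k > 0 the sum is multiplied by g^k when a is replaced by g a, and a^k = 1
has at most k < q - 1 solutions, so some g <> 0 has g^k <> 1.  For k = 0 the sum
is q = 0. *)
Lemma sum_expr_small k : (k < q.-1)%N -> \sum_(a : F) a ^+ k = 0.
Proof.
case: k => [_|k lt_kq].
  under eq_bigr do rewrite expr0.
  by rewrite sumr_const card_field_natr.
have [g g_neq0 gk_neq1] : exists2 g : F, g != 0 & g ^+ k.+1 != 1.
  apply/exists_inP; apply: contraLR lt_kq.
  rewrite negb_exists_in -leqNgt => /forall_inP all_root.
  rewrite -(cardC1 (0 : F)) cardE max_unity_roots ?enum_uniq //.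
  apply/allP=> a; rewrite mem_enum => /all_root.
  by rewrite negbK unity_rootE.
set s := (X in X = 0); have gs : g ^+ k.+1 * s = s.
  rewrite mulr_sumr [RHS](reindex_inj (mulfI g_neq0)) /=.
  by apply: eq_bigr => a _; rewrite exprMn.
move/eqP: gs; rewrite -subr_eq0 -{2}[s]mul1r -mulrBl mulf_eq0.
by rewrite subr_eq0 (negPf gk_neq1) /= => /eqP.
Qed.

Lemma expf_card_pred (a : F) : a != 0 -> a ^+ q.-1 = 1.
Proof.
move=> a_neq0; apply: (mulfI a_neq0).
by rewrite -exprS prednK ?expf_card ?mulr1 // ltnW ?finNzRing_gt1.
Qed.

Lemma sum_expr_top : \sum_(a : F) a ^+ q.-1 = -1.
Proof.
have q_gt1 := finNzRing_gt1 F; have q_gt0 := ltnW q_gt1.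
rewrite (bigD1 0) //= expr0n -subn1 subn_eq0 leqNgt q_gt1 add0r subn1.
rewrite (eq_bigr (fun=> 1)) => [|a a_neq0].
  rewrite sumr_const cardC1 -subn1 natrB // card_field_natr sub0r //.
exact: expf_card_pred.
Qed.

Lemma sum_horner (P : {poly F}) : (size P <= q)%N -> \sum_a P.[a] = - P`_q.-1.
Proof.
move=> szP; have q_gt0 : (0 < q)%N by apply/card_gt0P; exists 0.
under eq_bigr do rewrite (horner_coef_wide _ szP).
rewrite exchange_big /= -[in LHS](prednK q_gt0) big_ord_recr /=.
rewrite -mulr_sumr sum_expr_top mulrN1 big1 ?add0r // => i _.
by rewrite -mulr_sumr sum_expr_small ?mulr0.
Qed.

(** Weights that read off the coefficient of degree i of a polynomial of degree
at most q - 1 from its values.  The power sums give - a^(q-1-i); for i = 0 this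
weight would also pick up the coefficient of degree q - 1, and evaluation at 0
is used instead. *)
Definition coef_functional (i : 'I_q.-1.+1) (a : F) : F :=
  if i == 0%N :> nat then (a == 0)%:R else - a ^+ (q.-1 - i).

Lemma coef_functionalE (i j : 'I_q.-1.+1) :
  \sum_a coef_functional i a * a ^+ j = (i == j)%:R.
Proof.
rewrite /coef_functional; have [i0|i_neq0] := eqVneq (i : nat) 0%N.
  rewrite (bigD1 0) //= eqxx mul1r big1 ?addr0 => [|a /negPf->]; last first.
    by rewrite mul0r.
  by rewrite expr0n -val_eqE /= i0 eq_sym.
under eq_bigr do rewrite mulNr -exprD.
rewrite sumrN -val_eqE /=; have lt_iq := ltn_ord i; have lt_jq := ltn_ord j.
have [lt_ij|lt_ji|eq_ij] := ltngtP i j; first last.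
- by rewrite -eq_ij subnK // sum_expr_top opprK.
- rewrite sum_expr_small ?oppr0 //.
  by rewrite -[X in (_ < X)%N](@subnK i) ?ltn_add2l.
(* Here i < j, and a^q = a lowers the exponent by q - 1. *)
have -> : (q.-1 - i + j = q + (j - i).-1)%N.
  rewrite -[X in _ = (X + _)%N](prednK (ltnW (finNzRing_gt1 F))).
  by rewrite addSnnS (@prednK (j - i)) ?subn_gt0 // addnBAC // addnBA // ltnW.
under eq_bigr do rewrite exprD expf_card -exprS.
rewrite (@prednK (j - i)) ?subn_gt0 // sum_expr_small ?oppr0 //.
rewrite ltn_subLR; last exact: ltnW.
apply: (leq_ltn_trans (_ : j <= q.-1)%N); first by rewrite -ltnS.
by rewrite -[X in (X < _)%N]add0n ltn_add2r lt0n.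
Qed.

End PowerSums.

(** * Dimension of a dual code under extension of scalars

The words of the dual code are the solutions of a linear system over k, whose
rank is the same over k and over K. *)

Section ScalarExtension.

(** Each w t is a solution over K of the linear system that defines the dual
code, so independent w t are bounded in number by the dimension of the solution
space. *)
Lemma dim_dual_code_ge (k : finFieldType) (K : fieldType)
    (f : {rmorphism k -> K}) (I T : finType) (X : seq {ffun I -> k^o})
    (w : T -> I -> K) :
    (forall t v, v \in X -> \sum_i w t i * f (v i) = 0) ->
    (forall c, (forall i, \sum_t c t * w t i = 0) -> forall t, c t = 0) ->
  (#|T| <= \dim (dual_code <<X>>))%N.
Proof.
move=> w_dual w_free.
pose A := \matrix_(i < #|I|, j < size X)
  ((tnth (in_tuple X) j) (enum_val i) : k).
pose W := \matrix_(t < #|T|, i < #|I|) w (enum_val t) (enum_val i).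
have W_ker : (W <= kermx (map_mx f A))%MS.
  apply/sub_kermxP/matrixP=> t j; rewrite !mxE.
  rewrite -[RHS](w_dual (enum_val t) _ (mem_tnth j (in_tuple X))).
  rewrite [RHS](reindex _ (onW_bij _ (@enum_val_bij I))) /=.
  by apply: eq_bigr => i _; rewrite !mxE.
have rankW : \rank W = #|T|.
  apply/eqP/inj_row_free=> c cW0; apply/rowP=> t; rewrite mxE.
  have := w_free (fun t => c 0 (enum_rank t)) _ (enum_val t).
  rewrite enum_valK; apply=> i.
  have /rowP/(_ (enum_rank i)) := cW0; rewrite mxE [RHS]mxE => cW0i.
  rewrite -[RHS]cW0i.
  rewrite [LHS](reindex _ (onW_bij _ (@enum_val_bij T))) /=.
  by apply: eq_bigr => s _; rewrite mxE enum_valK enum_rankK.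
have le_rank : (#|T| <= \rank (kermx A))%N.
  by rewrite -rankW (leq_trans (mxrankS W_ker)) // -map_kermx mxrank_map.
apply: leq_trans le_rank _; set B := row_base (kermx A).
(* phi identifies the left kernel of A with words of the dual code. *)
pose phi (u : 'rV[k]_(\rank (kermx A))) : {ffun I -> k^o} :=
  [ffun i => (u *m B) 0 (enum_rank i)].
have phi_lin : linear phi.
  by move=> a u v; apply/ffunP=> i; rewrite !ffunE mulmxDl -scalemxAl !mxE.
pose phiL := linfun (HB.pack phi (GRing.isLinear.Build _ _ _ _ phi phi_lin)
                     : {linear _ -> _}).
have phi_inj : lker phiL == 0%VS.
  apply/lker0P=> u v; rewrite !lfunE /= => /ffunP eq_uv.
  apply: (row_free_inj (row_base_free (kermx A))); apply/rowP=> i.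
  by have := eq_uv (enum_val i); rewrite !ffunE enum_valK.
have <- : \dim (limg phiL) = \rank (kermx A).
  by rewrite limg_dim_eq ?dimvf ?(eqP phi_inj) ?capv0 //= /dim /= mul1n.
apply/dimvS/subvP=> _ /memv_imgP[u _ ->]; apply/mem_dual_code.
suff: (<<X>> <= lker (linfun (dotp (phiL u))))%VS.
  move=> /subvP X_perp v /X_perp; rewrite memv_ker lfunE /= => /eqP <-.
  by apply: eq_bigr => i _; rewrite mulrC.
apply/span_subvP=> v /(nthP 0)[j lt_j <-]; rewrite memv_ker !lfunE /=.
have /sub_kermxP uA0 : (u *m B <= kermx A)%MS by rewrite mulmx_sub ?eq_row_base.
have /rowP/(_ (Ordinal lt_j)) := uA0; rewrite mxE [RHS]mxE => uAj.
apply/eqP; rewrite -[RHS]uAj /dotp.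
rewrite [LHS](reindex _ (onW_bij _ (@enum_val_bij I))) /=.
by apply: eq_bigr => i _; rewrite ffunE enum_valK [A _ _]mxE (tnth_nth 0).
Qed.

End ScalarExtension.

(** * Cones over words on the points at infinity *)

Section Cone.

Variables (F : finFieldType) (n : nat) (R : nmodType).
Implicit Types (P D : pg_point F n) (L : pg_line F n) (x y : 'rV[F]_n).
Implicit Types (g : pg_point F n -> R).

(** The option-valued [insub] is None exactly at y = 0, where <y> is not a
point. *)
Definition cone g y : R := oapp g 0 (insub <[y]>%VS).

Lemma cone0 g : cone g 0 = 0.
Proof. by rewrite /cone insubF // dim_vline eqxx. Qed.

Lemma vline_pg_point P y : y != 0 -> y \in val P -> <[y]>%VS = val P.
Proof.
move=> y_neq0 yP; apply/eqP; rewrite -(dimv_leqif_eq (U := <[y]>%VS)).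
  by rewrite dim_vline y_neq0 (eqP (valP P)).
by rewrite -memvE.
Qed.

Lemma coneE g P y : y != 0 -> y \in val P -> cone g y = g P.
Proof. by move=> y_neq0 yP; rewrite /cone (vline_pg_point y_neq0 yP) valK. Qed.

Lemma mem_ag_line x D y : (y \in ag_line x D) = (y - x \in val D).
Proof.
apply/imsetP/idP => [[v /= vD ->]|yxD]; first by rewrite addrC addKr.
by exists (y - x); rewrite //= addrC subrK.
Qed.

Lemma dim_addv_pg_point D x : x \notin val D -> \dim (<[x]> + val D) = 2.
Proof.
move=> xD; apply/eqP; rewrite eqn_leq; apply/andP; split.
  rewrite (leq_trans (dimv_add_leqif _ _)) // (eqP (valP D)) dim_vline.
  by case: (x != 0).
have := ltn_leqif (dimv_leqif_eq (addvSr <[x]> (val D))).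
rewrite (eqP (valP D)) => ->.
by apply: contra xD => /eqP->; rewrite memvE addvSl.
Qed.

(** The points of L other than D correspond to the vectors of x + D: each of
them is spanned by exactly one such vector. *)
Lemma sum_pg_line g L D x : incident D L -> x \in val L -> x \notin val D ->
  \sum_(P | incident P L) g P = g D + \sum_(y in ag_line x D) cone g y.
Proof.
move=> DL xL xD; rewrite (bigD1 D) //=; congr (_ + _).
have line_neq0 y : y \in ag_line x D -> y != 0.
  apply: contraTneq => ->; rewrite mem_ag_line sub0r.
  by rewrite (memvN (val D)).
pose h y := insubd D <[y]>%VS.
have val_h y : y \in ag_line x D -> val (h y) = <[y]>%VS.
  by move=> /line_neq0 y_neq0; rewrite /h val_insubd dim_vline y_neq0.
have LE : val L = (<[x]> + val D)%VS.
  apply/esym/eqP; rewrite eqEdim subv_add -memvE xL [X in X && _]DL.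
  rewrite (eqP (valP L)) /=.
  by rewrite dim_addv_pg_point.
have h_inj : {in ag_line x D &, injective h}.
  move=> y z yA zA hyz.
  have : y \in <[z]>%VS by rewrite -(val_h z zA) -hyz val_h ?memv_line.
  case/vlineP=> c def_y; have [c1|c_neq1] := eqVneq c 1.
    by rewrite def_y c1 scale1r.
  case/negP: xD; move: yA zA; rewrite !mem_ag_line => yD zD.
  have : (y - x) - c *: (z - x) \in val D by rewrite rpredB ?rpredZ.
  rewrite def_y scalerBr opprB addrC addrA subrK.
  rewrite -[X in _ - X]scale1r -scalerBl => /(rpredZ (c - 1)^-1).
  by rewrite scalerA mulVf ?scale1r ?subr_eq0.
transitivity (\sum_(P in h @: ag_line x D) g P).
  apply: eq_bigl => P; apply/andP/imsetP => [[PL P_neqD]|[y yA ->]].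
    have z_neq0 : vpick (val P) != 0 by rewrite vpick0 -dimv_eq0 (eqP (valP P)).
    have := subvP PL _ (memv_pick (val P)); rewrite LE.
    (* A spanning vector c x + d of P has c <> 0, as P differs from D; dividing by
       c gives a vector of x + D. *)
    case/memv_addP=> _ /vlineP[c ->] [d dD def_z].
    have c_neq0 : c != 0.
      apply: contraNneq P_neqD => c0; rewrite -val_eqE.
      rewrite -(vline_pg_point z_neq0 (memv_pick _)); apply/eqP.
      by apply: vline_pg_point; rewrite // def_z c0 scale0r add0r.
    have yA : c^-1 *: vpick (val P) \in ag_line x D.
      rewrite mem_ag_line def_z scalerDr scalerA mulVf // scale1r addrC addKr.
      exact: rpredZ.
    exists (c^-1 *: vpick (val P)) => //; apply: val_inj; rewrite val_h //.
    by apply/esym/vline_pg_point; rewrite ?line_neq0 // rpredZ ?memv_pick.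
  rewrite /incident val_h // -memvE; split.
    by rewrite -(subrK x y) rpredD // (subvP DL) // -mem_ag_line.
  apply: contra xD => /eqP hyD; rewrite -(subKr y x) rpredB -?mem_ag_line //.
  by rewrite -hyD val_h ?memv_line.
rewrite big_imset //=; apply: eq_bigr => y yA.
by rewrite (@coneE g (h y)) ?val_h ?memv_line ?line_neq0.
Qed.

(** Here x + D = D, and its q - 1 nonzero vectors all span D. *)
Lemma sum_cone_origin g D x : x \in val D ->
  \sum_(y in ag_line x D) cone g y = g D *+ #|F|.-1.
Proof.
move=> xD; have D0 : 0 \in ag_line x D by rewrite mem_ag_line sub0r memvN.
rewrite (big_setD1 0) //= cone0 add0r.
rewrite (eq_bigr (fun=> g D)) => [|y].
  rewrite sumr_const; congr (_ *+ _).
  have := cardsD1 0 (ag_line x D); rewrite D0 card_imset; last exact: addrI.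
  by rewrite card_vspace (eqP (valP D)) expn1 => ->.
rewrite !inE mem_ag_line => /andP[y_neq0 yD]; apply: coneE => //.
by rewrite -(subrK x y) rpredD.
Qed.

End Cone.

(** * The dual code embeds into the functions on a Kakeya set *)

Section KakeyaBound.

Variables (p t n : nat) (F : finFieldType).
Hypotheses (p_pr : prime p) (t_gt0 : (0 < t)%N) (cardF : #|F| = (p ^ t)%N).
Local Notation C := (line_code p F n).

(** When x is not in D, orthogonality to the projective line <x> + D is the
claim; when x is in D, the sum is (q - 1) u(D), and q = 0 in GF(p). *)
Lemma sum_cone_dual_code (u : {ffun pg_point F n -> ('F_p)^o}) D x :
  u \in dual_code C -> \sum_(y in ag_line x D) cone u y = - u D.
Proof.
move=> /mem_dual_code uC; have [xD | xD] := boolP (x \in val D).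
  rewrite sum_cone_origin // -subn1 mulrnBr ?mulr1n; last first.
    by rewrite cardF expn_gt0 prime_gt0.
  rewrite -mulr_natr cardF natrX (pchar_Fp_0 p_pr) expr0n gtn_eqF //.
  by rewrite mulr0 sub0r.
have L2 : \dim (<[x]> + val D) == 2 by rewrite dim_addv_pg_point.
pose L : pg_line F n := Sub (<[x]> + val D)%VS L2.
have := uC (line_vector p L) (memv_span (map_f _ (mem_enum _ L))).
rewrite /dotp.
under eq_bigr do rewrite ffunE mulr_natl mulrb.
rewrite -big_mkcond (@sum_pg_line _ _ _ _ L D x) /incident ?addvSr //.
  by move/addr0_eq/esym.
by rewrite memvE addvSl.
Qed.

Lemma cone_is_linear (K : {set 'rV[F]_n}) :
  linear (fun u : {ffun pg_point F n -> ('F_p)^o} =>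
            [ffun y : {y | y \in K} => cone u (val y)] : {ffun _ -> ('F_p)^o}).
Proof.
move=> a u v; apply/ffunP=> y; rewrite !ffunE /cone.
by case: insub => [P|] /=; rewrite ?ffunE // scaler0 addr0.
Qed.

(** The line of K with direction D recovers u(D) from [cone u]. *)
Lemma kakeya_dim_dual_code (K : {set 'rV[F]_n}) :
  kakeya K -> (\dim (dual_code C) <= #|K|)%N.
Proof.
move=> hK.
pose phi := linfun (HB.pack (fun u : {ffun pg_point F n -> ('F_p)^o} =>
            [ffun y : {y | y \in K} => cone u (val y)] : {ffun _ -> ('F_p)^o})
   (GRing.isLinear.Build _ _ _ _ _ (cone_is_linear K)) : {linear _ -> _}).
have phi_inj : (dual_code C :&: lker phi = 0)%VS.
  apply/eqP; rewrite -subv0; apply/subvP=> u.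
  rewrite memv_cap memv_ker lfunE memv0 => /andP[uC /eqP /ffunP u0].
  apply/eqP/ffunP=> D; rewrite ffunE.
  have [x /subsetP xDK] := hK D.
  apply: oppr_inj; rewrite oppr0 -(sum_cone_dual_code _ x uC) big1 // => y yA.
  by have := u0 (Sub y (xDK y yA)); rewrite !ffunE SubK.
rewrite -(limg_dim_eq phi_inj) (leq_trans (dimvS (subvf _))) //.
by rewrite dimvf /dim /= card_sig muln1 cardE.
Qed.

End KakeyaBound.

(** * Coefficients of top degree in a product *)

Section TopCoefficient.

Variable R : comNzRingType.

(** The degree m is only a bound and c may be 0; for this reason the relation is
multiplicative, unlike the actual degree and leading coefficient over a ring
with zero divisors. *)
Definition top_coef m (P : {poly R}) c := (size P <= m.+1)%N /\ P`_m = c.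

Lemma top_coefM m1 m2 P1 P2 c1 c2 :
  top_coef m1 P1 c1 -> top_coef m2 P2 c2 ->
  top_coef (m1 + m2) (P1 * P2) (c1 * c2).
Proof.
move=> [sz1 <-] [sz2 <-]; split.
  by apply: leq_trans (size_polyMleq _ _) _; lia.
have lt_m1 : (m1 < (m1 + m2).+1)%N by rewrite ltnS leq_addr.
rewrite coefM (bigD1 (Ordinal lt_m1)) //= addKn big1 ?addr0 // => j.
rewrite -val_eqE /= neq_ltn => /orP[lt_j | gt_j].
  by rewrite (nth_default 0 (s := P2)) ?mulr0 // (leq_trans sz2) //; lia.
by rewrite (nth_default 0 (s := P1)) ?mul0r // (leq_trans sz1).
Qed.

Lemma top_coef_prod (I : finType) (m : I -> nat) (P : I -> {poly R}) c :
  (forall i, top_coef (m i) (P i) (c i)) ->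
  top_coef (\sum_i m i) (\prod_i P i) (\prod_i c i).
Proof.
move=> PE; apply: (big_rec3 (fun m P c => top_coef m P c)).
  by split; rewrite ?size_poly1 ?coef1.
by move=> i d Q b _; apply: top_coefM.
Qed.

Lemma top_coefX m P c : top_coef 1 P c -> top_coef m (P ^+ m) (c ^+ m).
Proof.
move=> PE; elim: m => [|m IHm].
  by split; rewrite ?expr0 ?size_poly1 ?coef1.
by rewrite !exprS -add1n; apply: top_coefM.
Qed.

End TopCoefficient.

(** * Monomials with exponents less than q *)

Section Monomials.

Variables (F : finFieldType) (n : nat).
Local Notation q := #|F|.
Implicit Types (m : n.-tuple 'I_q.-1.+1) (x y : 'rV[F]_n).

Definition monomial m x := \prod_(i < n) x 0 i ^+ tnth m i.

Lemma monomialZ m a x :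
  monomial m (a *: x) = a ^+ (\sum_i tnth m i) * monomial m x.
Proof.
rewrite /monomial -prodrXr -big_split /=.
by apply: eq_bigr => i _; rewrite mxE exprMn.
Qed.

(** Tensor products of the weights [coef_functional] form a dual basis. *)
Lemma monomial_free (c : n.-tuple 'I_q.-1.+1 -> F) :
  (forall x, \sum_m c m * monomial m x = 0) -> forall m, c m = 0.
Proof.
move=> c0 m.
pose dual m x := \prod_(i < n) coef_functional (tnth m i) (x 0 i).
have dualE m1 : \sum_x dual m x * monomial m1 x = (m == m1)%:R.
  have row_bij : bijective (fun f : {ffun 'I_n -> F} => \row_i f i).
    exists (fun x : 'rV_n => [ffun i => x 0 i]) => [f|x].
      by apply/ffunP=> i; rewrite ffunE mxE.
    by apply/rowP=> i; rewrite mxE ffunE.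
  rewrite (reindex _ (onW_bij _ row_bij)) /=.
  transitivity (\prod_(i < n) (tnth m i == tnth m1 i)%:R : F).
    under [RHS]eq_bigr do rewrite -coef_functionalE.
    rewrite bigA_distr_bigA /=; apply: eq_bigr => f _.
    by rewrite -big_split /=; apply: eq_bigr => i _; rewrite mxE.
  have [<-|m_neq] := eqVneq m m1; first by rewrite big1 // => i; rewrite eqxx.
  have /existsP[i m_i] : [exists i, tnth m i != tnth m1 i].
    rewrite -negb_forall; apply: contra m_neq => /forallP eq_m.
    by apply/eqP/eq_from_tnth => i; apply/eqP.
  by rewrite (bigD1 i) //= (negPf m_i) mul0r.
transitivity (\sum_x dual m x * \sum_m1 c m1 * monomial m1 x); last first.
  by rewrite big1 // => x _; rewrite c0 mulr0.
under eq_bigr do rewrite mulr_sumr.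
rewrite exchange_big (bigD1 m) //= [X in _ + X]big1 ?addr0 => [|m1 m1_neq].
  under eq_bigr do rewrite mulrCA.
  by rewrite -mulr_sumr dualE eqxx mulr1.
under eq_bigr do rewrite mulrCA.
by rewrite -mulr_sumr dualE eq_sym (negPf m1_neq) mulr0.
Qed.

(** On the line x + a d the monomial is a polynomial in a of degree at most
q - 1, whose coefficient of degree q - 1 is its value at d. *)
Lemma sum_monomial_line m x d : (\sum_i tnth m i = q.-1)%N ->
  \sum_a monomial m (x + a *: d) = - monomial m d.
Proof.
move=> deg_m.
pose P := \prod_(i < n) ((d 0 i)%:P * 'X + (x 0 i)%:P) ^+ tnth m i.
have [szP topP] : top_coef q.-1 P (monomial m d).
  rewrite -deg_m; apply: top_coef_prod => i; apply: top_coefX; split.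
    by rewrite size_MXaddC; case: ifP => // _; rewrite ltnS size_polyC_leq1.
  by rewrite coefD coefMX !coefC addr0.
rewrite -topP -sum_horner; last first.
  by rewrite (leq_trans szP) ?prednK // (ltnW (finNzRing_gt1 F)).
apply: eq_bigr => a _; rewrite horner_prod; apply: eq_bigr => i _.
by rewrite !mxE horner_exp !hornerE addrC mulrC.
Qed.

End Monomials.


(** * Words of the dual code from monomials of degree q - 1 *)

Section MonomialBound.

Variables (p t n : nat) (F : finFieldType).
Hypotheses (p_pr : prime p) (cardF : #|F| = (p ^ t)%N).
Local Notation q := #|F|.
Implicit Types (m : n.-tuple 'I_q.-1.+1) (x y d : 'rV[F]_n).
Implicit Types (D : pg_point F n) (L : pg_line F n).

(** A monomial of degree q - 1 takes the same value at all spanning vectors of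
P; [vpick] chooses one of them. *)
Definition monomial_word m (P : pg_point F n) := monomial m (vpick (val P)).

Lemma vpick_pg_point D : vpick (val D) != 0.
Proof. by rewrite vpick0 -dimv_eq0 (eqP (valP D)). Qed.

Lemma cone_monomial_word m y :
  (\sum_i tnth m i = q.-1)%N -> cone (monomial_word m) y = monomial m y.
Proof.
move=> deg_m; have q1_gt0 : (0 < q.-1)%N.
  by rewrite -subn1 subn_gt0 finNzRing_gt1.
have [->|y_neq0] := eqVneq y 0.
  by rewrite cone0 -(scale0r 0) monomialZ deg_m expr0n gtn_eqF ?mul0r.
have y_dim : \dim <[y]> == 1%N by rewrite dim_vline y_neq0.
rewrite (@coneE _ _ _ _ (Sub <[y]>%VS y_dim)) ?SubK ?memv_line //.
have := vpick_pg_point (Sub <[y]>%VS y_dim); rewrite /monomial_word SubK.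
have /vlineP[c ->] := memv_pick <[y]>.
rewrite scaler_eq0 negb_or => /andP[c_neq0 _].
by rewrite monomialZ deg_m expf_card_pred ?mul1r.
Qed.

Lemma big_ag_line (R : nmodType) (G : 'rV[F]_n -> R) x D :
  \sum_(y in ag_line x D) G y = \sum_a G (x + a *: vpick (val D)).
Proof.
have -> : ag_line x D = [set x + a *: vpick (val D) | a : F].
  apply/setP=> y; rewrite mem_ag_line.
  rewrite -{1}(vline_pg_point (vpick_pg_point D) (memv_pick _)).
  apply/vlineP/imsetP => [[a def_y]|[a _ ->]].
    by exists a; rewrite // -def_y addrC subrK.
  by exists a; rewrite addrC addKr.
rewrite big_imset //= => a b _ _ /addrI /eqP.
rewrite -subr_eq0 -scalerBl scaler_eq0 (negPf (vpick_pg_point D)) orbF subr_eq0.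
by move/eqP.
Qed.

Lemma sum_monomial_word m L :
  (\sum_i tnth m i = q.-1)%N -> \sum_(P | incident P L) monomial_word m P = 0.
Proof.
move=> deg_m.
have d_neq0 : vpick (val L) != 0 by rewrite vpick0 -dimv_eq0 (eqP (valP L)).
have D1 : \dim <[vpick (val L)]> == 1%N by rewrite dim_vline d_neq0.
pose D : pg_point F n := Sub <[vpick (val L)]>%VS D1.
have DL : incident D L by rewrite /incident SubK -memvE memv_pick.
have [x xL xD] : exists2 x, x \in val L & x \notin val D.
  apply/subvPn; apply: contraL (valP L) => /dimvS.
  by rewrite (eqP (valP D)); case: (\dim _) => [|[|]].
rewrite (sum_pg_line _ DL xL xD) big_ag_line.
under [X in _ + X]eq_bigr do rewrite cone_monomial_word //.
by rewrite sum_monomial_line // subrr.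
Qed.

(** The words of the monomials of degree q - 1 are independent, since the cones
over them are the monomials themselves. *)
Lemma monomial_dim_dual_code : (0 < n)%N ->
  ('C(n.-1 + q.-1, n.-1) <= \dim (dual_code (line_code p F n)))%N.
Proof.
move=> n_gt0.
pose A := [set m : n.-tuple 'I_q.-1.+1 | \sum_i tnth m i == q.-1]%N.
pose T := {m | m \in A}.
have deg_T (m : T) : (\sum_i tnth (val m) i = q.-1)%N.
  by apply/eqP; have := valP m; rewrite inE.
have -> : 'C(n.-1 + q.-1, n.-1) = #|{: T}|.
  rewrite -card_ord_partitions (prednK n_gt0) card_sig.
  by apply: eq_card => m; rewrite !inE big_tuple.
have pcharF : p \in [pchar F] := card_finPcharP cardF p_pr.
(* K is F with its structure of GF(p)-algebra. *)
pose K : fieldType := pPrimeCharType pcharF.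
pose f : {rmorphism 'F_p -> K} := in_alg K.
apply: (dim_dual_code_ge (f := f) (w := fun m : T => monomial_word (val m))).
  move=> m _ /mapP[L _ ->].
  rewrite -[RHS](sum_monomial_word L (deg_T m)) [RHS]big_mkcond.
  apply: eq_bigr => P _; rewrite ffunE rmorph_nat.
  by case: incident; rewrite ?mulr1 ?mulr0.
move=> c c0 m.
pose c' (s : n.-tuple 'I_q.-1.+1) : F := oapp c 0 (insub s).
have -> : c m = c' (val m) by rewrite /c' valK.
apply: monomial_free => x.
transitivity (\sum_(s : T) (c s : F) * monomial (val s) x).
  rewrite (bigID (mem A)) /= [X in _ + X]big1 ?addr0 => [|s sA].
    by rewrite big_sub; apply: eq_bigr => s _; rewrite /c' valK.
  by rewrite /c' insubF ?mul0r //; apply: negPf.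
have [->|x_neq0] := eqVneq x 0.
  rewrite big1 // => s _.
  by rewrite -cone_monomial_word ?deg_T // cone0 mulr0.
have x_dim : \dim <[x]> == 1%N by rewrite dim_vline x_neq0.
pose P : pg_point F n := Sub <[x]>%VS x_dim.
have monomial_x (s : T) : monomial (val s) x = monomial_word (val s) P.
  by rewrite -cone_monomial_word ?deg_T // (@coneE _ _ _ _ P) ?SubK ?memv_line.
under eq_bigr do rewrite monomial_x.
exact: (c0 P).
Qed.

End MonomialBound.

(** * The three bounds *)

Lemma leq_exp_ffact q k : (q ^ k <= (q + k.-1) ^_ k)%N.
Proof.
rewrite ffact_prod -[k in (q ^ k)%N]card_ord -prod_nat_const.
by apply: leq_prod => i _; have := ltn_ord i; lia.
Qed.

Theorem mainTheorem3 (n p t q : nat) (F : finFieldType)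
    (hn : (2 <= n)%N) (hp : prime p) (ht : (0 < t)%N) (hq : q = (p ^ t)%N)
    (hF : #|F| = q) (K : {set 'rV[F]_n}) (hK : kakeya K) :
  [/\ (\dim (dual_code (line_code p F n)) <= #|K|)%N,
      ('C(q + n - 2, n - 1) <= \dim (dual_code (line_code p F n)))%N &
      (q%:R ^+ (n - 1) / ((n - 1)`!)%:R <= 'C(q + n - 2, n - 1)%:R :> rat)].
Proof.
have cardF : #|F| = (p ^ t)%N by rewrite hF.
have q_gt0 : (0 < q)%N by rewrite hq expn_gt0 prime_gt0.
split.
- exact: (kakeya_dim_dual_code hp ht cardF).
- have := @monomial_dim_dual_code p t n F hp cardF (ltnW hn); rewrite hF.
  rewrite -subn1 (_ : n - 1 + q.-1 = q + n - 2)%N //; lia.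
rewrite ler_pdivrMr ?ltr0n ?fact_gt0 // -natrX -natrM ler_nat bin_ffact.
by rewrite (_ : q + n - 2 = q + (n - 1).-1)%N ?leq_exp_ffact //; lia.
Qed.
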